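(* Let $a$ be a positive integer such that $b^2<a<a+1<(b+1)^2$ for some integer $b\ge 1$. Then the largest perfect square not belonging to $\langle a,a+1\rangle$ is $$ {}^{2}r(\langle a,a+1\rangle)=(a-b)^2 . $$
   Context: $\langle s_1,s_2\rangle=\{x_1s_1+x_2s_2 : x_1,x_2 \text{ integers},\ x_1,x_2\ge 0\}$. For a numerical semigroup $S$ with $1\notin S$ (generated by relatively prime positive integers), ${}^{2}r(S)$ denotes the largest perfect square $m^2$ ($m\ge 1$ an integer) not belonging to $S$. *)

(* Defs.v *)
From mathcomp Require Import all_boot.

Set Implicit Arguments.
Unset Strict Implicit.
Unset Printing Implicit Defensive.

Definition semigroup2 (s1 s2 : nat) : nat -> Prop :=
  fun n => exists x1 x2 : nat, n = x1 * s1 + x2 * s2.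

Definition square_gap (S : nat -> Prop) (r : nat) : Prop :=
  (exists2 m : nat, 0 < m & r = m ^ 2) /\ ~ S r.

(* The relation "r = ^2r(S)".  It includes existence of the maximum, and r is
   unique by [largest_square_gap_unique]. *)
Definition is_largest_square_gap (S : nat -> Prop) (r : nat) : Prop :=
  square_gap S r /\ (forall q : nat, square_gap S q -> q <= r).

Lemma largest_square_gap_unique (S : nat -> Prop) (r r' : nat) :
  is_largest_square_gap S r -> is_largest_square_gap S r' -> r = r'.
Proof.
move=> [gr maxr] [gr' maxr']; apply/eqP.
by rewrite eqn_leq (maxr' _ gr) (maxr _ gr').
Qed.

(* Main.v *)
Require Import Defs.
From mathcomp Require Import all_boot.
From mathcomp Require Import zify.

(** The semigroup generated by [a] and [a + 1] is the union of the blocks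
    [k * a <= n <= k * (a + 1)] (lemma [semigroup2_consecutiveP]).  Writing a
    square below [a ^ 2] from the top as
      [(a - c) ^ 2 = (a - 2 * c) * a + c ^ 2],
    the offset [c ^ 2] lands in block number [a - 2 * c], whose length is
    [a - 2 * c], exactly when [c ^ 2 + 2 * c <= a], that is
    [(c + 1) ^ 2 <= a + 1].  As [b] is the integer square root of both [a] and
    [a + 1], this holds for [c < b] and fails for [c = b]; in the latter case
    [b ^ 2 < a] puts the square strictly before the next block.  The squares
    from [a ^ 2] on lie where consecutive blocks no longer leave a gap
    ([semigroup2_consecutive_large]). *)

(** A sum of [k] generators, [x2] of them equal to [a + 1], is
    [k * a + x2] with [x2 <= k] arbitrary. *)
Lemma semigroup2_consecutiveP (a n : nat) :
  semigroup2 a (a + 1) n <-> exists k, k * a <= n <= k * (a + 1).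
Proof.
split=> [[x1 [x2 ->]] | [k /andP[lo hi]]].
  by exists (x1 + x2); nia.
by exists (k - (n - k * a)), (n - k * a); nia.
Qed.

(** Block number [n %/ a] reaches [n] because its length, the quotient, is at
    least [a - 1], hence at least the remainder. *)
Lemma semigroup2_consecutive_large (a n : nat) :
  0 < a -> a * (a - 1) <= n -> semigroup2 a (a + 1) n.
Proof.
move=> a_gt0 le_n; apply/semigroup2_consecutiveP; exists (n %/ a).
have := divn_eq n a; have := ltn_pmod n a_gt0.
have : a - 1 <= n %/ a by rewrite leq_divRL // mulnC.
by move: (n %/ a) (n %% a) => q r; nia.
Qed.

Lemma square_in_semigroup2_consecutive (m c : nat) :
  c ^ 2 <= m - c -> c <= m -> semigroup2 (m + c) (m + c + 1) (m ^ 2).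
Proof.
move=> le_c2 /subnK Em; apply/semigroup2_consecutiveP; exists (m - c).
by move: (m - c) Em le_c2 => t <-; nia.
Qed.

(** With [t = m - c], [m ^ 2 = t * (m + c) + c ^ 2] lies strictly between the
    end of block number [t] and the start of block number [t + 1]. *)
Lemma square_notin_semigroup2_consecutive (m c : nat) :
  c <= m -> m - c < c ^ 2 < m + c -> ~ semigroup2 (m + c) (m + c + 1) (m ^ 2).
Proof.
move=> /subnK Em lt_c2 /semigroup2_consecutiveP [k].
move: (m - c) Em lt_c2 => t <- /andP[lt_t lt_c2] /andP[lo hi].
have [le_kt | lt_tk] := leqP k t.
  have : k * (t + c + c + 1) <= t * (t + c + c + 1) by rewrite leq_mul2r le_kt orbT.
  by nia.
have : t.+1 * (t + c + c) <= k * (t + c + c) by rewrite leq_mul2r lt_tk orbT.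
by nia.
Qed.

(* The hypotheses give b <= b ^ 2 < a, so the truncated a - b is the true one. *)
Theorem proposition4p1 (a b : nat) (a_gt0 : 0 < a) (b_ge1 : 1 <= b)
    (hab : [&& b ^ 2 < a, a < a + 1 & a + 1 < (b + 1) ^ 2]) :
  is_largest_square_gap (semigroup2 a (a + 1)) ((a - b) ^ 2).
Proof.
case/and3P: hab => lt_b2a _ lt_ab.
(* This is (b - 1) ^ 2 >= 0 combined with b ^ 2 < a. *)
have le_2b : 2 * b <= a by nia.
split.
  split; first by exists (a - b) => //; lia.
  have := @square_notin_semigroup2_consecutive (a - b) b.
  by rewrite subnK; [apply; nia | lia].
move=> _ [[m m_gt0 ->] notS]; rewrite leq_exp2r // leqNgt.
apply/negP => lt_m; apply: notS.
have [le_am | lt_ma] := leqP a m.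
  by apply: semigroup2_consecutive_large => //; nia.
pose c := a - m.
have lt_cb : c < b by rewrite /c; lia.
have Ea : a = m + c by rewrite /c; lia.
have le_c1 : (c + 1) ^ 2 <= b ^ 2 by rewrite leq_exp2r // addn1.
by rewrite Ea; apply: square_in_semigroup2_consecutive; nia.
Qed.
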